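(* Let $\mathcal{H}$ be a complex Hilbert space and let $T\in\mathcal{B}(\mathcal{H})$ be generalized Drazin invertible with closed range. Put $P=I-TT^d$, and let $$T=\begin{bmatrix} T_1 & 0\\ 0& T_2\end{bmatrix}:\begin{bmatrix}\mathcal{N}(P)\\ \mathcal{R}(P)\end{bmatrix}\to\begin{bmatrix}\mathcal{N}(P)\\ \mathcal{R}(P)\end{bmatrix}$$ be the core-quasinilpotent decomposition of $T$ (so $T_1$ is invertible and $T_2$ is quasinilpotent). For an inner inverse of $T$ of the form $$T^{-}=\begin{bmatrix} T_1^{-1} & Y\\ Z& T_2^{-}\end{bmatrix}:\begin{bmatrix}\mathcal{N}(P)\\ \mathcal{R}(P)\end{bmatrix}\to\begin{bmatrix}\mathcal{N}(P)\\ \mathcal{R}(P)\end{bmatrix},\quad \mathcal{R}(T_2)\subset\mathcal{N}(Y),\ \mathcal{R}(Z)\subset\mathcal{N}(T_2),$$ where $T_2^{-}$ is an inner inverse of $T_2$, the GD1 inverse of $T$ is given by $$T^{GD-}=\begin{bmatrix} T_1^{-1} & Y\\ 0& 0\end{bmatrix}=T^d+\begin{bmatrix} 0 & Y\\ 0& 0\end{bmatrix}:\begin{bmatrix}\mathcal{N}(P)\\ \mathcal{R}(P)\end{bmatrix}\to\begin{bmatrix}\mathcal{N}(P)\\ \mathcal{R}(P)\end{bmatrix}.$$ Consequently, $T^{GD-}=T^d$ if and only if $Y=0$.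
   Context: $\mathcal{B}(\mathcal{H})$ is the space of bounded linear operators on $\mathcal{H}$; $\mathcal{R}(\cdot)$ and $\mathcal{N}(\cdot)$ denote range and null space. An operator $Q$ is quasinilpotent if $\|Q^n\|^{1/n}\to0$. $T\in\mathcal{B}(\mathcal{H})$ is generalized Drazin invertible if there is $X\in\mathcal{B}(\mathcal{H})$ with $XTX=X$, $TX=XT$ and $T-T^2X$ quasinilpotent; such an $X$ is unique and is denoted $T^d$. An inner inverse of an operator $A$ is a bounded operator $A^{-}$ with $AA^{-}A=A$. It is known that $P=I-TT^d$ is an idempotent commuting with $T$ and that, relative to the direct sum $\mathcal{H}=\mathcal{N}(P)\oplus\mathcal{R}(P)$, $T$ is block diagonal with $T_1:\mathcal{N}(P)\to\mathcal{N}(P)$ invertible and $T_2:\mathcal{R}(P)\to\mathcal{R}(P)$ quasinilpotent; this is the core-quasinilpotent decomposition. The GD1 inverse of $T$ associated with a fixed inner inverse $T^{-}$ is $T^{GD-}=T^dTT^{-}$. *)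

(* Defs.v *)
From HB Require Import structures.
From mathcomp Require Import all_boot all_order all_algebra complex.
From mathcomp Require Import all_classical all_reals all_analysis.

Set Implicit Arguments.
Unset Strict Implicit.
Unset Printing Implicit Defensive.

Import Order.TTheory GRing.Theory Num.Theory.
Import numFieldNormedType.Exports.

Local Open Scope classical_set_scope.
Local Open Scope ring_scope.
Local Open Scope complex_scope.

(* [{dot H for conjC}] is linear in its first argument, conjugate-linear in
   the second one and positive definite. *)
HB.mixin Record CompleteNormedModule_isHilbert (R : realType) H
    of CompleteNormedModule R[i] H := {
  inner : {dot H for @Num.conj R[i]};
  normr_inner : forall x : H, `|x| ^+ 2 = inner x x
}.

#[short(type="hilbertType")]
HB.structure Definition Hilbert (R : realType) :=
  {H of CompleteNormedModule_isHilbert R H & CompleteNormedModule R[i] H}.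

Section BoundedOperators.
Context {K : numFieldType}.

Definition bounded_linear (U V : normedModType K) : {pred U -> V} :=
  fun f => `[< linear f /\ exists M : K, forall x, `|f x| <= M * `|x| >].

Arguments bounded_linear : clear implicits.

Record bop (U V : normedModType K) := Bop {
  bop_val :> U -> V;
  bop_valP : bop_val \in bounded_linear U V
}.

HB.instance Definition _ (U V : normedModType K) :=
  [isSub for @bop_val U V].
HB.instance Definition _ (U V : normedModType K) :=
  [Choice of bop U V by <:].

Lemma bounded_linearP (U V : normedModType K) (f : U -> V) :
  reflect (linear f /\ exists2 M : K, 0 <= M & forall x, `|f x| <= M * `|x|)
          (f \in bounded_linear U V).
Proof.
apply: (iffP (asboolP _)) => [[fl [M fM]]|[fl [M _ fM]]]; split=> //; last first.
  by exists M.
exists `|M| => // x; apply: le_trans (fM x) _.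
have M0 : 0 <= M * `|x| := le_trans (normr_ge0 _) (fM x).
by rewrite -(ger0_norm M0) normrM normr_id.
Qed.

Lemma bounded_linear_zmod (U V : normedModType K) :
  zmod_closed (bounded_linear U V).
Proof.
split=> [|f g /bounded_linearP[fl [M M0 fM]] /bounded_linearP[gl [N N0 gN]]].
  apply/bounded_linearP; split=> [a u v|].
    by rewrite -[(0 : U -> V) _]/(0 : V) -[X in _ *: X]/(0 : V) scaler0 add0r.
  by exists 0 => // x; rewrite mul0r normr0.
apply/bounded_linearP; split=> [a u v|].
  rewrite -[LHS]/(f _ - g _) -[RHS]/(a *: (f u - g u) + (f v - g v)).
  by rewrite fl gl scalerBr opprD addrACA.
exists (M + N); first exact: addr_ge0.
by move=> x; rewrite mulrDl (le_trans (ler_normB _ _))// lerD.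
Qed.

HB.instance Definition _ (U V : normedModType K) :=
  GRing.isZmodClosed.Build (U -> V) (bounded_linear U V)
    (bounded_linear_zmod U V).
HB.instance Definition _ (U V : normedModType K) :=
  [SubChoice_isSubZmodule of bop U V by <:].

Lemma bop_linear (U V : normedModType K) (A : bop U V) : linear A.
Proof. by case/bounded_linearP: (bop_valP A). Qed.

HB.instance Definition _ (U V : normedModType K) (A : bop U V) :=
  GRing.isLinear.Build K U V *:%R A (@bop_linear U V A).

Lemma bop_bounded (U V : normedModType K) (A : bop U V) :
  exists2 M : K, 0 <= M & forall x, `|A x| <= M * `|x|.
Proof. by case/bounded_linearP: (bop_valP A). Qed.

Lemma bopP (U V : normedModType K) (A B : bop U V) : A =1 B -> A = B.
Proof. by move=> AB; apply/val_inj/funext. Qed.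

Lemma bopDE (U V : normedModType K) (A B : bop U V) x : (A + B) x = A x + B x.
Proof. by []. Qed.

Lemma bopBE (U V : normedModType K) (A B : bop U V) x : (A - B) x = A x - B x.
Proof. by []. Qed.

Lemma bop0E (U V : normedModType K) x : (0 : bop U V) x = 0.
Proof. by []. Qed.

Lemma comp_bounded_linear (U V W : normedModType K)
  (A : bop V W) (B : bop U V) : A \o B \in bounded_linear U W.
Proof.
apply/bounded_linearP; split=> [a u v|] /=; first by rewrite !linearP.
have [M M0 AM] := bop_bounded A; have [N N0 BN] := bop_bounded B.
exists (M * N) => [|x]; first exact: mulr_ge0.
by rewrite (le_trans (AM _))// -mulrA ler_wpM2l.
Qed.

Definition bcomp (U V W : normedModType K) (A : bop V W) (B : bop U V) :
  bop U W := Bop (comp_bounded_linear A B).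

Lemma id_bounded_linear (U : normedModType K) : idfun \in bounded_linear U U.
Proof.
by apply/bounded_linearP; split=> //; exists 1 => // x; rewrite mul1r.
Qed.

Definition bid (U : normedModType K) : bop U U := Bop (id_bounded_linear U).

Section Ring.
Context (U : normedModType K).

Lemma bcompA : associative (@bcomp U U U).
Proof. by move=> A B C; apply: bopP. Qed.
Lemma bcomp1l : left_id (bid U) (@bcomp U U U).
Proof. by move=> A; apply: bopP. Qed.
Lemma bcomp1r : right_id (bid U) (@bcomp U U U).
Proof. by move=> A; apply: bopP. Qed.
Lemma bcompDl : left_distributive (@bcomp U U U) +%R.
Proof. by move=> A B C; apply: bopP. Qed.
Lemma bcompDr : right_distributive (@bcomp U U U) +%R.
Proof. by move=> A B C; apply: bopP => x; exact: (linearD A). Qed.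

(* The trivial space is allowed, hence a possibly zero ring. *)
HB.instance Definition _ := GRing.Zmodule_isPzRing.Build (bop U U)
  bcompA bcomp1l bcomp1r bcompDl bcompDr.

Lemma bopME (A B : bop U U) x : (A * B) x = A (B x).
Proof. by []. Qed.

Lemma bop1E x : (1 : bop U U) x = x.
Proof. by []. Qed.

Definition is_inverse (A X : bop U U) := A * X = 1 /\ X * A = 1.

Definition invertible (A : bop U U) := exists X, is_inverse A X.

Definition bop_inv (A : bop U U) : bop U U := xget 0 [set X | is_inverse A X].

Definition inner_inverse (A X : bop U U) := A * X * A = A.

End Ring.

Section KernelRange.
Context {U V : normedModType K}.

Definition null_space (A : bop U V) : {pred U} := fun x => A x == 0.

Definition range_space (A : bop U V) : {pred V} := fun y => y \in range A.

Lemma null_space_submod (A : bop U V) : submod_closed (null_space A).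
Proof.
split=> [|a u v]; rewrite !unfold_in; first by rewrite linear0.
by move=> /eqP Au /eqP Av; rewrite linearP /= Au Av scaler0 addr0.
Qed.

HB.instance Definition _ (A : bop U V) :=
  GRing.isSubmodClosed.Build K U (null_space A) (null_space_submod A).

Lemma range_space_submod (A : bop U V) : submod_closed (range_space A).
Proof.
split=> [|a _ _ /set_mem[u _ <-] /set_mem[v _ <-]]; apply/mem_set.
  by exists 0 => //; rewrite linear0.
by exists (a *: u + v) => //; rewrite linearP.
Qed.

HB.instance Definition _ (A : bop U V) :=
  GRing.isSubmodClosed.Build K V (range_space A) (range_space_submod A).

End KernelRange.

Section Subspaces.
Context {U : normedModType K}.

Record subsp (S : submodClosed U) := Subsp {
  subsp_val : U;
  subsp_valP : subsp_val \in S
}.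

HB.instance Definition _ (S : submodClosed U) := [isSub for @subsp_val S].
HB.instance Definition _ (S : submodClosed U) := [Choice of subsp S by <:].
HB.instance Definition _ (S : submodClosed U) :=
  [SubChoice_isSubLmodule of subsp S by <:].

Section Norm.
Context (S : submodClosed U).

Definition subsp_norm (x : subsp S) : K := `|val x|.

Lemma subsp_ler_normD x y :
  subsp_norm (x + y) <= subsp_norm x + subsp_norm y.
Proof. by rewrite /subsp_norm raddfD; exact: ler_normD. Qed.

Lemma subsp_normrZ a x : subsp_norm (a *: x) = `|a| * subsp_norm x.
Proof. by rewrite /subsp_norm linearZ; exact: normrZ. Qed.

Lemma subsp_normr0_eq0 x : subsp_norm x = 0 -> x = 0.
Proof. by move=> /normr0_eq0 x0; apply: val_inj; rewrite x0 raddf0. Qed.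

HB.instance Definition _ := Lmodule_isNormed.Build K (subsp S)
  subsp_ler_normD subsp_normrZ subsp_normr0_eq0.

Lemma subsp_val_bounded_linear :
  (val : subsp S -> U) \in bounded_linear (subsp S) U.
Proof.
apply/bounded_linearP; split=> [a u v|]; first by rewrite linearP.
by exists 1 => // x; rewrite mul1r.
Qed.

Definition incl : bop (subsp S) U := Bop subsp_val_bounded_linear.

Lemma corestr_bounded_linear (V : normedModType K) (A : bop V U)
    (AS : forall x, A x \in S) :
  (fun x => Subsp (AS x)) \in bounded_linear V (subsp S).
Proof.
apply/bounded_linearP; split=> [a u v|].
  by apply: val_inj; rewrite [RHS]linearP; exact: (linearP A).
by have [M M0 AM] := bop_bounded A; exists M.
Qed.

Definition corestr (V : normedModType K) (A : bop V U)
  (AS : forall x, A x \in S) : bop V (subsp S) := Bop (corestr_bounded_linear AS).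

End Norm.
End Subspaces.

Section Blocks.
Context {U : normedModType K} (P : bop U U).

Notation NP := (subsp (null_space P)).
Notation RP := (subsp (range_space P)).

Hypothesis PP : P * P = P.

Lemma idem_null_space x : (1 - P) x \in null_space P.
Proof.
by rewrite unfold_in bopBE bop1E linearB /= -bopME PP subrr.
Qed.

Lemma idem_range_space x : P x \in range_space P.
Proof. by apply/mem_set; exists x. Qed.

Definition null_proj : bop U NP := corestr idem_null_space.

Definition range_proj : bop U RP := corestr idem_range_space.

(* The operator on U with matrix [A B; C D] relative to N(P) (+) R(P), P being
   idempotent. *)
Definition block (A : bop NP NP) (B : bop RP NP) (C : bop NP RP)
    (D : bop RP RP) : bop U U :=
  bcomp (incl _) (bcomp A null_proj + bcomp B range_proj) +
  bcomp (incl _) (bcomp C null_proj + bcomp D range_proj).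

Lemma blockE A B C D (u : NP) (v : RP) :
  block A B C D (val u + val v) = val (A u + B v) + val (C u + D v).
Proof.
have Pu : P (val u) = 0 by apply/eqP; exact: (subsp_valP u).
have Pv : P (val v) = val v.
  have /set_mem[w _ wv] := subsp_valP v.
  by rewrite -[val v]wv -bopME PP.
have Puv : P (val u + val v) = val v by rewrite linearD /= Pu Pv add0r.
have uE : null_proj (val u + val v) = u.
  apply: val_inj; rewrite -[LHS]/(val u + val v - P (val u + val v)).
  by rewrite Puv addrK.
have vE : range_proj (val u + val v) = v by apply: val_inj.
by rewrite -[LHS]/(val (A (null_proj _) + B (range_proj _)) +
  val (C (null_proj _) + D (range_proj _))) uE vE.
Qed.

End Blocks.
End BoundedOperators.

Section GeneralizedDrazin.
Context {R : realType}.

(* The norm of a normed module over R[i] takes its values in R[i]. *)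
Definition op_norm (U V : normedModType R[i]) (A : bop U V) : R :=
  sup [set complex.Re `|A x| | x in [set x : U | `|x| <= 1]].

Definition quasinilpotent (U : normedModType R[i]) (Q : bop U U) :=
  op_norm (Q ^+ n) `^ n%:R^-1 @[n --> \oo] --> (0 : R).

Section Inverse.
Context {U : normedModType R[i]} (T : bop U U).

Definition is_gDrazin (X : bop U U) :=
  [/\ X * T * X = X, T * X = X * T & quasinilpotent (T - T ^+ 2 * X)].

Definition gDrazin_invertible := exists X, is_gDrazin X.

(* T^d; unique when it exists. *)
Definition gDrazin : bop U U := xget 0 [set X | is_gDrazin X].

Definition core_idem : bop U U := 1 - T * gDrazin.

Lemma gDrazinP : gDrazin_invertible -> is_gDrazin gDrazin.
Proof. by case=> X TX; exact: (xgetI 0 TX). Qed.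

Lemma core_idem_idem : gDrazin_invertible -> core_idem * core_idem = core_idem.
Proof.
move=> /gDrazinP[XTX _ _]; rewrite /core_idem mulrBr mulr1 mulrBl mul1r.
by rewrite -[X in _ - (_ - X)]mulrA (mulrA gDrazin) XTX subrr subr0.
Qed.

Definition core_block (hT : gDrazin_invertible) := block (core_idem_idem hT).

Definition core_quasinilpotent_decomposition (hT : gDrazin_invertible)
    (T1 : bop (subsp (null_space core_idem)) (subsp (null_space core_idem)))
    (T2 : bop (subsp (range_space core_idem)) (subsp (range_space core_idem))) :=
  [/\ T = core_block hT T1 0 0 T2, invertible T1 & quasinilpotent T2].

(* Tm stands for the fixed inner inverse of T. *)
Definition GD1_inverse (Tm : bop U U) : bop U U := gDrazin * T * Tm.

End Inverse.
End GeneralizedDrazin.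

Notation core_space T := (subsp (null_space (core_idem T))).
Notation quasinilpotent_space T := (subsp (range_space (core_idem T))).

(* Main.v *)
(* With P = I - T T^d = I - T^d T, the product T^d T T^- = (I - P) T^- is the
   first row of T^-.  On N(P), T^d inverts T, hence T1; on R(P) it vanishes, as
   T^d P = 0.  So T^d has T1^-1 as its only nonzero block. *)
Require Import Defs.
From HB Require Import structures.
From mathcomp Require Import all_boot all_order all_algebra complex.
From mathcomp Require Import all_classical all_reals all_analysis.

Set Implicit Arguments.
Unset Strict Implicit.
Unset Printing Implicit Defensive.

Import Order.TTheory GRing.Theory Num.Theory.
Import numFieldNormedType.Exports.

Local Open Scope classical_set_scope.
Local Open Scope ring_scope.

Section Blocks.
Context {K : numFieldType} {U : normedModType K} (P : bop U U).
Hypothesis PP : P * P = P.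

Lemma null_spaceK (u : subsp (null_space P)) : P (val u) = 0.
Proof. by apply/eqP; exact: (subsp_valP u). Qed.

Lemma range_spaceK (v : subsp (range_space P)) : P (val v) = val v.
Proof.
by have /set_mem[w _ wv] := subsp_valP v; rewrite -[val v]wv -bopME PP.
Qed.

Lemma idemD (u : subsp (null_space P)) (v : subsp (range_space P)) :
  P (val u + val v) = val v.
Proof. by rewrite linearD [LHS]/= null_spaceK range_spaceK add0r. Qed.

(** Each [x] splits as [(x - P x) + P x], with summands in [N(P)] and [R(P)]. Identities between
    block operators can thus be checked one column at a time. *)
Lemma bop_eq_idem (A B : bop U U) :
  (forall u : subsp (null_space P), A (val u) = B (val u)) ->
  (forall v : subsp (range_space P), A (val v) = B (val v)) ->
  A = B.
Proof.
move=> ABu ABv; apply: bopP => x.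
have -> : x = val (null_proj PP x) + val (range_proj P x).
  by rewrite -[RHS]/(x - P x + P x) subrK.
by move: (null_proj PP x) (range_proj P x) => u v; rewrite !linearD /= ABu ABv.
Qed.

Lemma block_null A B C D u : block PP A B C D (val u) = val (A u) + val (C u).
Proof.
by have := blockE PP A B C D u 0; rewrite [val 0]raddf0 !linear0 !addr0.
Qed.

Lemma block_range A B C D v : block PP A B C D (val v) = val (B v) + val (D v).
Proof.
by have := blockE PP A B C D 0 v; rewrite [val 0]raddf0 !linear0 !add0r.
Qed.

(** [1 - P] is the projection onto [N(P)] along [R(P)]: it fixes the part of the output in [N(P)]
    and kills the part in [R(P)], so only the first row survives. *)
Lemma compl_mul_block A B C D : (1 - P) * block PP A B C D = block PP A B 0 0.
Proof.
by apply: bop_eq_idem => w;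
  rewrite bopME bopBE bop1E ?block_null ?block_range idemD addrK bop0E raddf0
          addr0.
Qed.

Lemma block0 : block PP 0 0 0 0 = 0.
Proof.
by apply: bop_eq_idem => w;
  rewrite ?block_null ?block_range !bop0E !raddf0 addr0.
Qed.

Lemma block_upperD A B :
  block PP A B 0 0 = block PP A 0 0 0 + block PP 0 B 0 0.
Proof.
by apply: bop_eq_idem => w;
  rewrite bopDE ?block_null ?block_range !bop0E !raddf0 ?addr0 ?add0r.
Qed.

(** On [R(P)] this block operator acts as [B] followed by the injective inclusion of [N(P)], so it
    determines [B]. *)
Lemma block_upper_eq0 B : block PP 0 B 0 0 = 0 <-> B = 0.
Proof.
split=> [B0|->]; last exact: block0.
apply: bopP => v; apply: val_inj.
have := block_range 0 B 0 0 v.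
by rewrite B0 !bop0E !raddf0 addr0 => <-.
Qed.

End Blocks.

(** Invertibility rules out the default value 0 of [xget] in [bop_inv]. *)
Lemma bop_invP {K : numFieldType} {U : normedModType K} (A : bop U U) :
  invertible A -> is_inverse A (bop_inv A).
Proof. by case=> X AX; exact: (xgetI 0 AX). Qed.

Section GeneralizedDrazin.
Context {R : realType} {U : normedModType R[i]%C} (T : bop U U).
Hypothesis hT : gDrazin_invertible T.

Lemma gDrazin_mulT : gDrazin T * T = 1 - core_idem T.
Proof. by have [_ TX _] := gDrazinP hT; rewrite /core_idem subKr TX. Qed.

Lemma gDrazin_core_idem : gDrazin T * core_idem T = 0.
Proof.
have [XTX _ _] := gDrazinP hT.
by rewrite /core_idem mulrBr mulr1 mulrA XTX subrr.
Qed.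

Lemma gDrazin_block T1 T2 : core_quasinilpotent_decomposition hT T1 T2 ->
  gDrazin T = core_block hT (bop_inv T1) 0 0 0.
Proof.
move=> [TE /bop_invP[T1K _] _]; apply: (bop_eq_idem (core_idem_idem hT)) => w.
  rewrite block_null bop0E raddf0 addr0.
  (* On [N(P)], [T] acts as [T1], so [w = T v] with [v = T1^-1 w]. Then
     [T^d w = T^d T v = (1 - P) v = v], because [P v = 0]. *)
  have TV : T (val (bop_inv T1 w)) = val w.
    by rewrite {1}TE block_null bop0E raddf0 addr0 -bopME T1K.
  by rewrite -{1}TV -bopME gDrazin_mulT bopBE bop1E null_spaceK subr0.
rewrite block_range !bop0E !raddf0 addr0.
(* A vector of [R(P)] equals its image under [P], and [T^d P = 0]. *)
by rewrite -(range_spaceK (core_idem_idem hT)) -bopME gDrazin_core_idem.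
Qed.

End GeneralizedDrazin.

Theorem theorem1 (R : realType) (H : hilbertType R) (T : bop H H)
    (hT : gDrazin_invertible T) (rT : closed (range T))
    (T1 : bop (core_space T) (core_space T))
    (T2 : bop (quasinilpotent_space T) (quasinilpotent_space T))
    (hT12 : core_quasinilpotent_decomposition hT T1 T2)
    (Tm : bop H H)
    (Y : bop (quasinilpotent_space T) (core_space T))
    (Z : bop (core_space T) (quasinilpotent_space T))
    (T2m : bop (quasinilpotent_space T) (quasinilpotent_space T))
    (hTm : inner_inverse T Tm)
    (hTmE : Tm = core_block hT (bop_inv T1) Y Z T2m)
    (hT2m : inner_inverse T2 T2m)
    (hY : {subset range_space T2 <= null_space Y})
    (hZ : {subset range_space Z <= null_space T2}) :
  [/\ GD1_inverse T Tm = core_block hT (bop_inv T1) Y 0 0,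
      core_block hT (bop_inv T1) Y 0 0 = gDrazin T + core_block hT 0 Y 0 0
    & GD1_inverse T Tm = gDrazin T <-> Y = 0].
Proof.
have TdE := gDrazin_block hT12.
have GD1E : GD1_inverse T Tm = core_block hT (bop_inv T1) Y 0 0.
  (* Since [T^d T = 1 - P], the product discards the second row [Z], [T2m] of [Tm]. *)
  by rewrite /GD1_inverse gDrazin_mulT// hTmE /core_block compl_mul_block.
have GD1D : core_block hT (bop_inv T1) Y 0 0 = gDrazin T + core_block hT 0 Y 0 0.
  by rewrite TdE; exact: block_upperD.
(* The GD1 inverse differs from [T^d] by the block operator whose only entry is [Y]; the two agree
   exactly when that operator vanishes. *)
split=> //; rewrite GD1E GD1D -(block_upper_eq0 (core_idem_idem hT)).
rewrite -/(core_block hT 0 Y 0 0); split=> [DY|->]; last exact: addr0.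
by apply: (addrI (gDrazin T)); rewrite addr0.
Qed.
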